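(* Let $n \in \mathbb{N}$ and $\varepsilon \geq 0$. The following are equivalent: (1) there exists $s=(s_1,\dots,s_n)\in\mathbb{N}^n$ with $\delta_n(s)=\sup_{t\in\mathbb{R}}\min_{1\le i\le n}\|s_i t\|\le\varepsilon$; (2) there exists $a=(a_1,\dots,a_n)$ with all $a_i$ irrational and $\lambda_n(a)=\sup_{q\in\mathbb{Z}}\min_{1\le i\le n}\|q a_i\|\le\varepsilon$. Consequently $\inf_{a\in\mathbb{I}^n}\lambda_n(a)=\inf_{s\in\mathbb{N}^n}\delta_n(s)$.
   Context: $\mathbb{N}=\{1,2,3,\dots\}$, $\mathbb{I}$ denotes the set of irrational real numbers. For $x\in\mathbb{R}$, $\|x\|$ is the distance from $x$ to the nearest integer. *)

(* Defs.v *)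
From HB Require Import structures.
From mathcomp Require Import all_boot all_order all_algebra.
From mathcomp Require Import all_classical all_reals.

Set Implicit Arguments.
Unset Strict Implicit.
Unset Printing Implicit Defensive.

Import Order.TTheory GRing.Theory Num.Theory.

Local Open Scope classical_set_scope.
Local Open Scope ring_scope.

(* The distance from x to the nearest integer, ||x||: the infimum is attained
   and lies in [0, 1/2]. *)
Definition dist_int (R : realType) (x : R) : R :=
  inf (range (fun m : int => `|x - m%:~R|)).

(* Families of length n >= 1 are indexed by 'I_n with n = k.+1, so that the
   minimum is over a nonempty index set; seeding the fold with the value at
   ord0, which is itself in the range, leaves the minimum unchanged. *)
Definition min_fam (R : realType) (k : nat) (F : 'I_k.+1 -> R) : R :=
  \big[Num.min/F ord0]_(i < k.+1) F i.

(* In delta and lambda the sets are nonempty and contained in [0, 1/2], so the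
   real-valued sup is the genuine supremum. *)
Definition delta (R : realType) (k : nat) (s : 'I_k.+1 -> nat) : R :=
  sup (range (fun t : R => min_fam (fun i => dist_int ((s i)%:R * t)))).

Definition lambda (R : realType) (k : nat) (a : 'I_k.+1 -> R) : R :=
  sup (range (fun q : int => min_fam (fun i => dist_int (q%:~R * a i)))).

Definition pos_fam (k : nat) : set ('I_k.+1 -> nat) :=
  [set s | forall i, (0 < s i)%N].

Definition irrational_fam (R : realType) (k : nat) : set ('I_k.+1 -> R) :=
  [set a | forall i, irrational (a i)].

(* Main.v *)
Require Import Defs.
From HB Require Import structures.
From mathcomp Require Import all_boot all_order all_algebra.
From mathcomp Require Import all_classical all_reals.
From mathcomp Require Import topology normedtype sequences realfun trigo.
From mathcomp Require Import pi_irrational.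
From mathcomp Require Import ring lra.

Set Implicit Arguments.
Unset Strict Implicit.
Unset Printing Implicit Defensive.

Import Order.TTheory GRing.Theory Num.Theory.
Import numFieldNormedType.Exports.

Local Open Scope classical_set_scope.
Local Open Scope ring_scope.

(* Given s, the family a_i = s_i pi satisfies lambda a <= delta s, since the
   points q a are among the points s t.
   Conversely, let L be the group of integer vectors h with h . a an integer.
   As no a_i is rational, no unit vector lies in the rational span of L, so
   some integer vector s orthogonal to L has all its entries nonzero. By
   Kronecker's theorem every point of the line R s is, modulo Z^n, a limit of
   points q a, whence delta s <= lambda a.
   Kronecker's theorem is proved with the kernel
   F y = prod_j (1 + cos (2 pi y_j))^p, whose Fourier coefficients are
   nonnegative: up to a bounded error, the sum of F (q a - c) over q < N is
   largest when c is a shift x satisfying h . x in Z for all h in L. Summing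
   over the points c of a grid of mesh 1/m, that sum for x is at least
   N m^-n (1 + cos (2 pi / m))^(n p). If every q a had a coordinate at distance
   at least e from that of x modulo 1, it would be at most
   N ((1 + cos (2 pi e)) 2^(n - 1))^p, which is impossible for m and then p
   large. *)

(** * Distance to the nearest integer *)

Section DistInt.
Variable R : realType.
Implicit Types x y c : R.

Lemma dist_int_le x (m : int) : dist_int x <= `|x - m%:~R|.
Proof. by apply: ge_inf; [exists 0 => _ [j _ <-] | exists m]. Qed.

Lemma le_dist_int x c : (forall m : int, c <= `|x - m%:~R|) -> c <= dist_int x.
Proof.
move=> h; apply: lb_le_inf; first by exists `|x - 0%:~R|, 0.
by move=> _ [m _ <-].
Qed.

Lemma dist_int_ge0 x : 0 <= dist_int x.
Proof. exact: le_dist_int. Qed.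

Lemma dist_intN x : dist_int (- x) = dist_int x.
Proof.
suff le y : dist_int (- y) <= dist_int y.
  by apply/eqP; rewrite eq_le le -{1}[x]opprK le.
apply: le_dist_int => m; rewrite (le_trans (dist_int_le _ (- m))) //.
by rewrite mulrNz -opprD normrN.
Qed.

Lemma dist_intD x y : dist_int (x + y) <= dist_int x + dist_int y.
Proof.
rewrite -lerBlDl; apply: le_dist_int => m.
rewrite lerBlDl -lerBlDr; apply: le_dist_int => l; rewrite lerBlDr.
apply: (le_trans (dist_int_le _ (l + m))).
by rewrite rmorphD /= opprD addrACA ler_normD.
Qed.

Lemma near_int x : exists m : int, `|x - m%:~R| <= 2^-1.
Proof.
exists (Num.floor (x + 2^-1)).
have /andP[] := floor_itv (x + 2^-1); rewrite rmorphD /= ler_norml => h1 h2.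
by apply/andP; split; lra.
Qed.

Lemma dist_int_half x : dist_int x <= 2^-1.
Proof. by have [m] := near_int x; apply: le_trans; exact: dist_int_le. Qed.

End DistInt.

(** * The 1-periodic cosine: monotonicity, bounded sums, grid points *)

Section Wave.
Variable R : realType.
Implicit Types u v x e : R.

Definition wave x : R := cos (pi *+ 2 * x).

Lemma wave0 : wave 0 = 1. Proof. by rewrite /wave mulr0 cos0. Qed.

Lemma waveN x : wave (- x) = wave x. Proof. by rewrite /wave mulrN cosN. Qed.

Lemma wave_norm x : wave `|x| = wave x.
Proof. by case: (ger0P x) => // _; rewrite waveN. Qed.

Lemma wave_le1 x : wave x <= 1. Proof. exact: cos_le1. Qed.

Lemma wave_geN1 x : -1 <= wave x. Proof. exact: cos_geN1. Qed.

Lemma waveDB u v : wave (u + v) + wave (u - v) = 2 * wave u * wave v.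
Proof. by rewrite /wave mulrDr mulrBr cosD cosB; ring. Qed.

Lemma waveDz x (m : int) : wave (x + m%:~R) = wave x.
Proof.
have waveDn y n : wave (y + n%:R) = wave y.
  elim: n => [|n IHn]; first by rewrite addr0.
  rewrite -IHn -addn1 natrD addrA /wave [LHS]/= mulrDr mulr1; exact: cosD2pi.
case: m => n; first exact: waveDn.
by rewrite NegzE -(waveDn _ n.+1) mulrNz subrK.
Qed.

Lemma wave_decr u v : 0 <= u -> u < v -> v <= 2^-1 -> wave v < wave u.
Proof.
move=> u0 uv v2; have pi0 : 0 < pi :> R := pi_gt0 R.
have E z : pi *+ 2 * z = pi * (2 * z) by rewrite -mulr_natl; ring.
have I z : 0 <= z -> z <= 2^-1 -> pi * (2 * z) \in `[0, pi :> R].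
  move=> z0 z2; rewrite in_itv /= mulr_ge0 ?(ltW pi0) ?mulr_ge0 //=.
  by rewrite -[leRHS]mulr1 ler_pM2l //; lra.
rewrite /wave !E ltr_cos ?I //; [|lra..].
by rewrite ltr_pM2l // ltr_pM2l.
Qed.

Lemma wave_nincr u v : 0 <= u -> u <= v -> v <= 2^-1 -> wave v <= wave u.
Proof.
move=> u0; rewrite le_eqVlt => /orP[/eqP-> //|uv] v2.
by rewrite ltW // wave_decr.
Qed.

(** An integer shift brings the argument into [-1/2, 1/2], where [wave] decreases in the absolute
    value. *)
Lemma wave_far x e : 0 <= e -> e <= dist_int x -> wave x <= wave e.
Proof.
move=> e0 ex; have [m xm] := near_int x.
rewrite -[x](subrK m%:~R) waveDz -wave_norm wave_nincr //.
by rewrite (le_trans ex) // dist_int_le.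
Qed.

Lemma wave_lt1 x : x \isn't a Num.int -> wave x < 1.
Proof.
move=> xZ; have [m xm] := near_int x.
rewrite -[x](subrK m%:~R) waveDz -wave_norm -[ltRHS]wave0 wave_decr //.
rewrite normr_gt0 subr_eq0; apply: contraNneq xZ => ->.
exact: intr_int.
Qed.

(* 2 (1 - wave u) times the sum telescopes, by the product-to-sum formula. *)
Lemma wave_sum_bounded u v : u \isn't a Num.int ->
  exists C, forall N, `|\sum_(q < N) wave (q%:R * u + v)| <= C.
Proof.
move=> /wave_lt1; rewrite -subr_gt0 => u1.
pose D q := wave (q%:R * u + v) - wave (q%:R * u + v - u).
have le2 q : `|D q| <= 2.
  have := wave_le1 (q%:R * u + v); have := wave_geN1 (q%:R * u + v).
  have := wave_le1 (q%:R * u + v - u); have := wave_geN1 (q%:R * u + v - u).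
  by rewrite ler_norml /D => *; apply/andP; split; lra.
exists (2 / (1 - wave u)) => N.
have tele : 2 * (1 - wave u) * (\sum_(q < N) wave (q%:R * u + v)) = D 0%N - D N.
  elim: N => [|N IHN]; first by rewrite big_ord0 mulr0 subrr.
  rewrite big_ord_recr mulrDr IHN /= /D.
  have := waveDB (N%:R * u + v) u.
  have -> : N.+1%:R * u + v = N%:R * u + v + u by rewrite -natr1; ring.
  by rewrite addrK => h; lra.
have := le2 0%N; have := le2 N; rewrite !ler_norml => /andP[? ?] /andP[? ?].
rewrite -mulNr ler_pdivrMr // ler_pdivlMr //.
by apply/andP; split; lra.
Qed.

(** Take [g] to be the floor of [z * m] reduced modulo [m]: the quotient is an integer shift,
    invisible to [wave], and the remaining offset lies in [0, 1/m]. *)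
Lemma wave_grid m (z : R) : (1 < m)%N ->
  exists g : 'I_m, wave m%:R^-1 <= wave (z - g%:R / m%:R).
Proof.
move=> m1; have m0 : 0 < m%:R :> R by rewrite ltr0n ltnW.
pose f := Num.floor (z * m%:R).
have mz : (m : int) != 0 by rewrite -lt0n ltnW.
have gm : (`|(f %% m)%Z| < m)%N.
  by rewrite -ltz_nat gez0_abs ?modz_ge0 // ltz_pmod // ltz_nat ltnW.
exists (Ordinal gm) => /=; rewrite natr_absz ger0_norm ?modz_ge0 //.
have -> : z - (f %% m)%Z%:~R / m%:R = z - f%:~R / m%:R + (f %/ m)%Z%:~R.
  have {1}-> : f%:~R = (f %/ m)%Z%:~R * m%:R + (f %% m)%Z%:~R :> R.
    by rewrite {1}(divz_eq f m) rmorphD rmorphM.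
  by field; rewrite gt_eqF.
have /andP[lo hi] := floor_itv (z * m%:R).
rewrite -/f rmorphD /= in lo hi.
rewrite waveDz wave_nincr //.
- by rewrite subr_ge0 ler_pdivrMr.
- by rewrite lerBlDr -{1}[m%:R^-1]mul1r -mulrDl ler_pdivlMr // addrC ltW.
- by rewrite lef_pV2 ?posrE // ler_nat.
Qed.

End Wave.

(** Lets N tend to infinity in the kernel sums, which discards the bounded error. *)
Lemma bounded_multiples_le0 (R : realType) (d C : R) :
  (forall N : nat, N%:R * d <= C) -> d <= 0.
Proof.
move=> h; rewrite leNgt; apply/negP => d0.
have := h (Num.truncn (C / d)).+1; rewrite leNgt -ltr_pdivrMr //.
by rewrite truncnS_gt.
Qed.

Lemma expr_dominates (R : realType) (M A B : R) : 0 <= B -> B < A ->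
  exists p, M * B ^+ p < A ^+ p.
Proof.
move=> B0 BA; have A0 := le_lt_trans B0 BA.
have r1 : `|B / A| < 1.
  by rewrite ger0_norm ?divr_ge0 ?(ltW A0) // ltr_pdivrMr ?mul1r.
have [p _ /(_ p (leqnn p))] := cvgr_lt _ (cvg_geometric M r1) _ ltr01.
rewrite /geometric /= expr_div_n mulrA ltr_pdivrMr ?exprn_gt0 // mul1r => ?.
by exists p.
Qed.

(** * Kronecker's theorem by Riesz products *)

Section Kronecker.
Variables (R : realType) (n : nat).
Implicit Types (a c x y : 'I_n -> R) (h k : 'I_n -> int).

Definition dotz h y : R := \sum_i (h i)%:~R * y i.

Lemma dotzDl h k y : dotz (fun i => h i + k i) y = dotz h y + dotz k y.
Proof.
by rewrite -big_split; apply: eq_bigr => i _; rewrite rmorphD mulrDl.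
Qed.

Lemma dotzBl h k y : dotz (fun i => h i - k i) y = dotz h y - dotz k y.
Proof.
by rewrite -sumrB; apply: eq_bigr => i _; rewrite rmorphB mulrBl.
Qed.

Lemma dotz_orbit h a c (q : R) :
  dotz h (fun i => q * a i - c i) = q * dotz h a + - dotz h c.
Proof.
by rewrite mulr_sumr -sumrB; apply: eq_bigr => i _; rewrite mulrBr mulrCA.
Qed.

(** A Riesz product; taking the frequencies as a list lets repetitions produce powers of a
    factor. *)
Definition riesz (ks : seq ('I_n -> int)) y : R :=
  \prod_(k <- ks) (1 + wave (dotz k y)).

(* When h . a is an integer all the phases of the x-sum vanish, so its terms
   dominate those of the c-sum; the other frequencies have bounded sums. *)
Lemma riesz_shift a x c :
    (forall h, dotz h a \is a Num.int -> dotz h x \is a Num.int) ->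
  forall ks h, exists C, forall N,
    \sum_(q < N) riesz ks (fun i => q%:R * a i - c i)
                 * wave (dotz h (fun i => q%:R * a i - c i)) <=
    \sum_(q < N) riesz ks (fun i => q%:R * a i - x i)
                 * wave (dotz h (fun i => q%:R * a i - x i)) + C.
Proof.
move=> ax; elim=> [|k ks IH] h.
  rewrite /riesz; case: (boolP (dotz h a \is a Num.int)) => ha.
    exists 0 => N; rewrite addr0; apply: ler_sum => q _.
    rewrite !big_nil !mul1r !dotz_orbit (le_trans (wave_le1 _)) //.
    have /intrP[u hu] := ha; have /intrP[v hv] := ax h ha.
    have -> : q%:R * dotz h a + - dotz h x = 0 + ((q : int) * u - v)%:~R.
      by rewrite add0r rmorphB rmorphM hu hv.
    by rewrite waveDz wave0.
  have [C1 le1] := wave_sum_bounded (- dotz h c) ha.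
  have [C2 le2] := wave_sum_bounded (- dotz h x) ha.
  exists (C1 + C2) => N; have := le1 N; have := le2 N.
  rewrite !ler_norml => /andP[lo _] /andP[_ hi].
  have E z : \sum_(q < N)
      \prod_(k <- [::]) (1 + wave (dotz k (fun i => q%:R * a i - z i))) *
      wave (dotz h (fun i => q%:R * a i - z i)) =
             \sum_(q < N) wave (q%:R * dotz h a + - dotz h z).
    by apply: eq_bigr => q _; rewrite big_nil mul1r dotz_orbit.
  rewrite !E; lra.
have [C0 le0] := IH h.
have [Cp lep] := IH (fun i => h i + k i).
have [Cm lem] := IH (fun i => h i - k i).
(* The factor of [k] turns frequency [h] into [h], [h + k], [h - k] with weights 1, 1/2, 1/2. These
   are nonnegative, so the three inductive inequalities add up. *)
have split_factor z N :
  \sum_(q < N) riesz (k :: ks) (fun i => q%:R * a i - z i)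
               * wave (dotz h (fun i => q%:R * a i - z i)) =
  \sum_(q < N) riesz ks (fun i => q%:R * a i - z i)
               * wave (dotz h (fun i => q%:R * a i - z i)) +
  2^-1 * (\sum_(q < N) riesz ks (fun i => q%:R * a i - z i)
               * wave (dotz (fun i => h i + k i) (fun i => q%:R * a i - z i)) +
          \sum_(q < N) riesz ks (fun i => q%:R * a i - z i)
               * wave (dotz (fun i => h i - k i) (fun i => q%:R * a i - z i))).
  rewrite -big_split mulr_sumr -big_split; apply: eq_bigr => q _ /=.
  by rewrite -mulrDr dotzDl dotzBl waveDB /riesz big_cons; field.
exists (C0 + 2^-1 * (Cp + Cm)) => N; rewrite !split_factor.
move: (le0 N) (lep N) (lem N) => h1 h2 h3; lra.
Qed.

Definition basisz : seq ('I_n -> int) :=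
  [seq fun i => (i == j)%:Z | j <- enum 'I_n].

(** Exhibits the kernel F as a Riesz product, so that [riesz_shift] applies to it. *)
Lemma riesz_basis p y :
  riesz (flatten (nseq p basisz)) y = (\prod_j (1 + wave (y j))) ^+ p.
Proof.
rewrite /riesz big_flatten /= big_nseq -(iter_mulr_1 p).
congr (iter p _ 1); congr ( *%R); rewrite big_map big_enum.
apply: eq_bigr => j _; congr (1 + wave _).
rewrite /dotz (bigD1 j) //= eqxx mul1r big1 ?addr0 // => i /negPf->.
exact: mul0r.
Qed.

(** By continuity at 0, where [1 + wave] equals 2. *)
Lemma wave_near1 (b : R) : b < 2 ^+ n ->
  exists2 m, (1 < m)%N & b < (1 + wave m%:R^-1) ^+ n.
Proof.
move=> b2.
pose f : R -> R := fun z => (1 + wave z) ^+ n.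
have : f z @[z --> 0] --> f 0.
  apply: (@continuous_comp _ _ _ (fun z => 1 + wave z) (fun z => z ^+ n)).
    apply: continuousD; first exact: cvg_cst.
    apply: (@continuous_comp _ _ _ (fun z => pi *+ 2 * z) cos).
      by apply: continuousM; [exact: cvg_cst|exact: cvg_id].
    exact: continuous_cos.
  exact: exprn_continuous.
have f0 : f 0 = 2 ^+ n by rewrite /f wave0.
rewrite f0 => /(cvgr_gt _)/(_ _ b2)/nbhs_ballP[r /= r0 near0].
have [m rm] := ltr_add_invr r0; rewrite add0r in rm.
(* [m.+1] is already large enough for [r]; one more ensures [1 < m.+2]. *)
exists m.+2 => //; apply: near0.
rewrite /ball /= sub0r normrN ger0_norm ?invr_ge0 //.
by apply: le_lt_trans rm; rewrite lef_pV2 ?posrE // ler_nat.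
Qed.

Lemma kronecker a x e :
    (forall h, dotz h a \is a Num.int -> dotz h x \is a Num.int) ->
    0 < e ->
  exists q : nat, forall i, dist_int (q%:R * a i - x i) < e.
Proof.
move=> ax e0; apply: contrapT => far.
have {}far q : exists i, e <= dist_int (q%:R * a i - x i).
  apply: contrapT => near; apply: far; exists q => i.
  by rewrite ltNge; apply/negP => ei; apply: near; exists i.
(* The failure at q = 0 supplies an index, so [n] is positive, and forces [e <= 1/2], the range
   where [wave] decreases. *)
have [i0 ei0] := far 0%N.
have n0 : (0 < n)%N by apply: leq_trans (ltn_ord i0).
have w1 : wave e < 1.
  by rewrite -[ltRHS]wave0 wave_decr // (le_trans ei0) // dist_int_half.
have F0 y : 0 <= \prod_j (1 + wave (y j)).
  by apply: prodr_ge0 => j _; rewrite -lerBlDl sub0r wave_geN1.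
(* The far coordinate contributes at most [1 + wave e], each of the others at most 2. *)
pose B := (1 + wave e) * 2 ^+ n.-1.
have B0 : 0 <= B by rewrite mulr_ge0 ?exprn_ge0 // -lerBlDl sub0r wave_geN1.
have FB q : \prod_j (1 + wave (q%:R * a j - x j)) <= B.
  have [i ei] := far q; rewrite (bigD1 i) //=.
  apply: ler_pM.
  - by rewrite -lerBlDl sub0r wave_geN1.
  - by apply: prodr_ge0 => j _; rewrite -lerBlDl sub0r wave_geN1.
  - by rewrite lerD2l wave_far // ltW.
  have -> : 2 ^+ n.-1 = \prod_(j < n | j != i) 2 :> R.
    by rewrite prodr_const cardC1 card_ord.
  apply: ler_prod => j _; rewrite -lerBlDl sub0r wave_geN1 /=.
  by have := wave_le1 (q%:R * a j - x j); lra.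
have [m m1 BA] : exists2 m, (1 < m)%N & B < (1 + wave m%:R^-1) ^+ n.
  apply: wave_near1; rewrite /B -{2}(prednK n0) exprS ltr_pM2r ?exprn_gt0 //.
  lra.
set A := _ ^+ n in BA.
pose grid (g : {ffun 'I_n -> 'I_m}) i : R := (g i)%:R / m%:R.
(* The power [p] must beat the number of grid points, which is fixed once [m] is. *)
have [p ltp] := expr_dominates (#|{ffun 'I_n -> 'I_m}|%:R : R) B0 BA.
pose ks := flatten (nseq p basisz).
(* At frequency 0 the extra cosine factor is 1, leaving the bare kernel sums. *)
have [C leC] := choice (fun c => riesz_shift c ax ks (fun=> 0)).
suff : A ^+ p - #|{ffun 'I_n -> 'I_m}|%:R * B ^+ p <= 0.
  by rewrite subr_le0 leNgt ltp.
apply: (@bounded_multiples_le0 R _ (\sum_g C (grid g))) => N.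
have dot0 y : wave (dotz (fun=> 0) y) = 1.
  by rewrite /dotz big1 ?wave0 // => i _; rewrite mul0r.
have {}leC c : \sum_(q < N) (\prod_j (1 + wave (q%:R * a j - c j))) ^+ p <=
               N%:R * B ^+ p + C c.
  have := leC c N.
  have E z : \sum_(q < N) riesz ks (fun i => q%:R * a i - z i)
               * wave (dotz (fun=> 0) (fun i => q%:R * a i - z i)) =
             \sum_(q < N) (\prod_j (1 + wave (q%:R * a j - z j))) ^+ p.
    by apply: eq_bigr => q _; rewrite riesz_basis dot0 mulr1.
  rewrite !E => /le_trans; apply; rewrite lerD2r.
  rewrite mulr_natl -[X in _ *+ X](card_ord N) -sumr_const.
  by apply: ler_sum => q _; rewrite lerXn2r ?nnegrE.
(* Some grid point is close to the orbit point in every coordinate modulo 1; its term alone reaches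
   [A ^+ p], and the other terms are nonnegative. *)
have cover (q : 'I_N) : A ^+ p <=
    \sum_g (\prod_j (1 + wave (q%:R * a j - grid g j))) ^+ p.
  have [g hg] := choice (fun j => wave_grid (q%:R * a j) m1).
  rewrite (bigD1 [ffun j => g j]) //= -[leLHS]addr0 lerD //; last first.
    by apply: sumr_ge0 => ? _; rewrite exprn_ge0.
  have w0 : 0 <= 1 + wave m%:R^-1 :> R by rewrite -lerBlDl sub0r wave_geN1.
  rewrite lerXn2r ?nnegrE ?exprn_ge0 //.
  rewrite /A -[X in _ ^+ X](card_ord n) -prodr_const; apply: ler_prod => j _.
  by rewrite w0 lerD2l /grid ffunE hg.
rewrite mulrBr lerBlDr.
have -> : N%:R * A ^+ p = \sum_(q < N) A ^+ p.
  by rewrite sumr_const card_ord mulr_natl.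
apply: (le_trans (ler_sum _ (fun q _ => cover q))).
rewrite exchange_big /=.
apply: (le_trans (ler_sum _ (fun g _ => leC (grid g)))).
by rewrite big_split /= sumr_const addrC lerD2l -[leLHS]mulr_natl mulrCA.
Qed.

End Kronecker.

(** * Rational relations and an orthogonal integer vector *)

Section IntegerDirection.
Variables (R : realType) (n : nat) (a : 'I_n -> R).

(** The rational span of the group L: clearing denominators takes such a vector into L. *)
Definition rat_rel (u : 'rV[rat]_n) : Prop :=
  rational (\sum_j ratr (u 0 j) * a j).

Lemma rat_rel_comb c u v : rat_rel u -> rat_rel v -> rat_rel (c *: u + v).
Proof.
move=> [r _ ru] [s _ sv]; exists (c * r + s) => //.
rewrite rmorphD rmorphM /= ru sv mulr_sumr -big_split; apply: eq_bigr => j _ /=.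
by rewrite !mxE rmorphD rmorphM /= mulrDl mulrA.
Qed.

Lemma rat_rel0 : rat_rel 0.
Proof.
exists 0 => //; rewrite rmorph0 big1 // => j _.
by rewrite mxE rmorph0 mul0r.
Qed.

(** Take [B] of maximal rank among matrices whose row space consists of relations: adjoining a
    further relation cannot raise the rank, so it already lies in the row space. *)
Lemma rat_rel_mx : exists B : 'M[rat]_n, forall u, (u <= B)%MS <-> rat_rel u.
Proof.
pose P r := `[< exists B : 'M[rat]_n,
  \rank B = r /\ forall u : 'rV_n, (u <= B)%MS -> rat_rel u >].
have exP : exists r, P r.
  exists 0%N; apply/asboolP; exists 0; split; first exact: mxrank0.
  by move=> u; rewrite submx0 => /eqP->; exact: rat_rel0.
have ubP r : P r -> (r <= n)%N.
  by move=> /asboolP[B [<- _]]; exact: rank_leq_row.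
have [r /asboolP[B [rB relB]] rmax] := ex_maxnP exP ubP.
exists B => u; split=> [|relu]; first exact: relB.
suff: (B + u <= B)%MS by apply: submx_trans; exact: addsmxSr.
rewrite -(geq_leqif (mxrank_leqif_sup (addsmxSl B u))) rB.
apply: rmax; apply/asboolP; exists (B + u)%MS; split=> // v.
move=> /sub_addsmxP[[w1 w2] /= ->].
rewrite addrC [w2]mx11_scalar mul_scalar_mx; apply: rat_rel_comb => //.
by apply: relB; exact: submxMl.
Qed.

End IntegerDirection.

(** The integers below [size p] are too many to be all roots. *)
Lemma poly_nonroot (p : {poly rat}) : p != 0 -> exists x, p.[x] != 0.
Proof.
move=> p0; apply: contrapT => nex.
have := max_poly_roots p0 (rs := [seq (i%:R : rat) | i <- iota 0 (size p)]).
rewrite size_map size_iota ltnn => H; suff: false by [].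
apply: H.
  apply/allP => x _; apply/negPn/negP => px; apply: nex; exists x.
  by rewrite -rootE.
rewrite map_inj_uniq ?iota_uniq // => i j /eqP.
by rewrite eqr_nat => /eqP.
Qed.

(** On the moment curve [x ^+ j] each row becomes a nonzero polynomial in [x]; a nonroot of their
    product serves all rows at once. *)
Lemma avoid_hyperplanes m n (C : 'M[rat]_(m, n)) :
  (forall i, row i C != 0) -> exists z : 'cV_n, forall i, (C *m z) i 0 != 0.
Proof.
move=> C0; pose p i : {poly rat} := \sum_j C i j *: 'X^j.
have p0 i : p i != 0.
  apply: contraNneq (C0 i) => pi0; apply/eqP/rowP => j; rewrite !mxE.
  rewrite -(coef0 _ j) -pi0 coef_sum (bigD1 j) //= big1 => [|k kj].
    by rewrite coefZ coefXn eqxx mulr1 addr0.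
  move: kj; rewrite -val_eqE eq_sym coefZ coefXn => /negPf /= ->.
  by rewrite mulr0.
have [x] : exists x, (\prod_i p i).[x] != 0.
  by apply: poly_nonroot; apply/prodf_neq0 => i _; exact: p0.
rewrite horner_prod => /prodf_neq0 px.
exists (\col_j x ^+ j) => i; have := px i isT.
congr (_ != _); rewrite horner_sum mxE; apply: eq_bigr => j _.
by rewrite !hornerE mxE.
Qed.

Lemma clear_denominators n (w : 'I_n -> rat) :
  exists2 D : int, D != 0 & exists s : 'I_n -> int,
    forall i, (s i)%:~R = D%:~R * w i.
Proof.
exists (\prod_i denq (w i)); first by apply/prodf_neq0 => i _; exact: denq_neq0.
exists (fun i => numq (w i) * \prod_(j | j != i) denq (w j)) => i.
rewrite [in RHS](bigD1 i) //= !intrM mulrAC; congr (_ * _).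
by rewrite numqE mulrC.
Qed.

Lemma integer_direction (R : realType) n (a : 'I_n -> R) :
    (forall i, irrational (a i)) ->
  exists2 s : 'I_n -> int, (forall i, s i != 0) &
    forall h, dotz h a \is a Num.int -> \sum_i h i * s i = 0.
Proof.
move=> irr; have [B relB] := rat_rel_mx a.
(* Every [cokermx B *m z] is orthogonal to the row space of [B]. If row [i] of [cokermx B] vanished,
   the i-th unit vector would be a relation and [a i] rational. *)
have [z w0] : exists z : 'cV_n, forall i, (cokermx B *m z) i 0 != 0.
  apply: avoid_hyperplanes => i; apply/negP => Ci; apply: (irr i).
  have /relB[r _ rE] : ((delta_mx 0 i : 'rV_n) <= B)%MS by rewrite submxE -rowE.
  exists r => //; rewrite rE (bigD1 i) //= big1 => [|j ji].
    by rewrite mxE !eqxx rmorph1 mul1r addr0.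
  by rewrite mxE (negPf ji) andbF rmorph0 mul0r.
have [D D0 [s sE]] := clear_denominators (fun i => (cokermx B *m z) i 0).
exists s => [i|h /intrP[r hr]].
  by rewrite -(intr_eq0 rat) sE mulf_neq0 ?intr_eq0.
have : (\row_j (h j)%:~R <= B)%MS.
  apply/relB; exists r%:~R => //; rewrite ratr_int -hr; apply: eq_bigr => j _.
  by rewrite mxE ratr_int.
rewrite submxE => /eqP hC.
have := congr1 (fun M => (M *m z) 0 0) hC.
rewrite -mulmxA mul0mx [LHS]mxE [RHS]mxE => hw.
have sw : ((\sum_i h i * s i)%:~R : rat) =
    D%:~R * \sum_j (\row_j (h j)%:~R) 0 j * (cokermx B *m z) j 0.
  rewrite rmorph_sum mulr_sumr; apply: eq_bigr => i _ /=.
  by rewrite intrM sE mxE mulrCA.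
by apply/eqP; rewrite -(intr_eq0 rat) sw hw mulr0.
Qed.

(** * Minima of families and the two comparisons of [lambda] with [delta] *)

Section MinFam.
Variables (R : realType) (k : nat).
Implicit Types (F a : 'I_k.+1 -> R) (c : R) (s : 'I_k.+1 -> nat).

Lemma min_fam_le F i : min_fam F <= F i.
Proof. exact: bigmin_le. Qed.

Lemma le_min_fam F c : (forall i, c <= F i) -> c <= min_fam F.
Proof. by move=> h; apply: le_bigmin. Qed.

Lemma le_delta s t : min_fam (fun i => dist_int ((s i)%:R * t)) <= delta R s.
Proof.
apply: ub_le_sup; last by exists t.
exists 2^-1 => _ [u _ <-].
by rewrite (le_trans (min_fam_le _ ord0)) ?dist_int_half.
Qed.

Lemma le_lambda a (q : int) :
  min_fam (fun i => dist_int (q%:~R * a i)) <= lambda a.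
Proof.
apply: ub_le_sup; last by exists q.
exists 2^-1 => _ [u _ <-].
by rewrite (le_trans (min_fam_le _ ord0)) ?dist_int_half.
Qed.

Lemma delta_le s c :
  (forall t, min_fam (fun i => dist_int ((s i)%:R * t)) <= c) -> delta R s <= c.
Proof.
move=> h; apply: ge_sup => [|_ [t _ <-]] //.
by exists (min_fam (fun i => dist_int ((s i)%:R * 0))), 0.
Qed.

Lemma lambda_le a c :
  (forall q : int, min_fam (fun i => dist_int (q%:~R * a i)) <= c) ->
  lambda a <= c.
Proof.
move=> h; apply: ge_sup => [|_ [t _ <-]] //.
by exists (min_fam (fun i => dist_int (0%:~R * a i))), 0.
Qed.

Lemma delta_ge0 s : 0 <= delta R s.
Proof.
by apply: le_trans (le_delta s 0); apply: le_min_fam => i; exact: dist_int_ge0.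
Qed.

Lemma lambda_ge0 a : 0 <= lambda a.
Proof.
by apply: le_trans (le_lambda a 0); apply: le_min_fam => i; exact: dist_int_ge0.
Qed.

Lemma exists_lambda_le_delta s : pos_fam s ->
  exists2 a : 'I_k.+1 -> R, irrational_fam a & lambda a <= delta R s.
Proof.
move=> s0; exists (fun i => (s i)%:R * pi).
  move=> i [r _ rE]; apply: (@pi_irrationnal R); exists (r / (s i)%:R) => //.
  rewrite fmorph_div /= rE ratr_nat mulrAC divff ?mul1r //.
  by rewrite pnatr_eq0 -lt0n s0.
apply: lambda_le => q; apply: le_trans (le_delta s (q%:~R * pi)).
by under eq_fun do rewrite mulrCA.
Qed.

Lemma exists_delta_le_lambda a : irrational_fam a ->
  exists2 s : 'I_k.+1 -> nat, pos_fam s & delta R s <= lambda a.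
Proof.
move=> /integer_direction[s s0 sL].
(* The direction may have negative entries; absolute values are harmless because [dist_int] is
   even. *)
exists (fun i => `|s i|%N) => [i|]; first by rewrite /= absz_gt0.
apply: delta_le => t; apply/ler_addgt0Pr => e e0.
(* The target [t s] is admissible: when [h . a] is an integer, [h . s = 0], hence
   [h . (t s) = 0]. *)
have [|q hq] := @kronecker R _ a (fun i => (s i)%:~R * t) e _ e0.
  move=> h /sL hs.
  have -> : dotz h (fun i => (s i)%:~R * t) = 0; last exact: int_num0.
  transitivity ((\sum_i h i * s i)%:~R * t); last by rewrite hs mul0r.
  rewrite rmorph_sum mulr_suml; apply: eq_bigr => i _ /=.
  by rewrite intrM mulrA.
rewrite -lerBlDr; apply: le_trans (le_lambda a q); apply: le_min_fam => i.
rewrite lerBlDr; apply: le_trans (min_fam_le _ i) _.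
have -> : dist_int (`|s i|%N%:R * t) = dist_int ((s i)%:~R * t).
  rewrite natr_absz; have [_|_] := ger0P (s i) => //.
  by rewrite mulrNz mulNr dist_intN.
rewrite -[X in dist_int X](subrK (q%:R * a i)) addrC.
rewrite (le_trans (dist_intD _ _)) //.
by rewrite lerD2l -dist_intN opprB ltW.
Qed.

End MinFam.

Theorem theorem7 (R : realType) (k : nat) :
  (forall eps : R, 0 <= eps ->
     (exists s : 'I_k.+1 -> nat, pos_fam s /\ delta R s <= eps) <->
     (exists a : 'I_k.+1 -> R, irrational_fam a /\ lambda a <= eps)) /\
  inf [set lambda a | a in @irrational_fam R k] =
  inf [set delta R s | s in @pos_fam k].
Proof.
split=> [eps _|].
  split=> [[s [/(exists_lambda_le_delta R)[a irr las] le]]|].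
    by exists a; split=> //; exact: le_trans le.
  move=> [a [/exists_delta_le_lambda[s s0 dsa] le]].
  by exists s; split=> //; exact: le_trans le.
(* The all-ones family makes both sets of values nonempty, as needed to bound each infimum from
   below. *)
have pos1 : pos_fam (fun _ : 'I_k.+1 => 1%N) by [].
have [a1 irr1 _] := exists_lambda_le_delta R pos1.
apply/eqP; rewrite eq_le; apply/andP; split; apply: lb_le_inf.
- by exists (delta R (fun _ : 'I_k.+1 => 1%N)), (fun=> 1%N).
- move=> _ [s /(exists_lambda_le_delta R)[a irr las] <-]; apply: le_trans las.
  by apply: ge_inf; [exists 0 => _ [b _ <-]; exact: lambda_ge0 | exists a].
- by exists (lambda a1), a1.
- move=> _ [a /exists_delta_le_lambda[s s0 dsa] <-]; apply: le_trans dsa.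
  by apply: ge_inf; [exists 0 => _ [b _ <-]; exact: delta_ge0 | exists s].
Qed.
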